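(* Let $(\Lambda,\eta)$ be an isothermic surface in $S^{3}$, fix a non-zero $w\in\mathbb{R}^{4,1}$ and consider the lift $F:\Sigma\to E(w)$ of $\Lambda$. Let $(u,v)$ be conformal curvature line coordinates corresponding to $\eta$, so that the first and second fundamental forms of $F$ (with respect to a unit normal in $E(w)$) are $I=e^{2\theta}(\mathrm{d}u^{2}+\mathrm{d}v^{2})$ and $I\!I=e^{2\theta}(k_{1}\mathrm{d}u^{2}+k_{2}\mathrm{d}v^{2})$. Put $H=\frac{k_{1}+k_{2}}{2}$, $L=e^{2\theta}(k_{1}-k_{2})$, $M=-HL$ and $K=-(w,w)$. Assume that $H_{u}H_{v}$ is never zero. Then $(\Lambda,\eta)$ is special isothermic of type $2$ in the space-form $E(w)$ if and only if there are real constants $A,B,C,D$ such that $$e^{2\theta}(H_{u}^{2}+H_{v}^{2})+\frac{1}{4}M^{2}+AM-2BH+CL+D+\frac{1}{4}L^{2}K=0 .$$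
   Context: $\mathbb{R}^{4,1}$ denotes $\mathbb{R}^{5}$ with an inner product $(\cdot,\cdot)$ of signature $(4,1)$, $\mathcal{L}$ its light-cone, and $S^3\cong\mathbb{P}(\mathcal{L})$. $\Sigma$ is a connected smooth surface, $\underline{\mathbb{R}}^{4,1}=\Sigma\times\mathbb{R}^{4,1}$, with trivial flat connection $\mathrm{d}$. A map $\Sigma\to S^3$ is identified with a null line subbundle $\Lambda\subset\underline{\mathbb{R}}^{4,1}$; a lift is a never-vanishing section $F$ of $\Lambda$; $\Lambda$ is an immersion iff $\langle F,\mathrm{d}F(T\Sigma)\rangle$ is a subbundle of rank $3$. Identify $\bigwedge^2\mathbb{R}^{4,1}$ with $\mathrm{o}(\mathbb{R}^{4,1})$ by $(u\wedge v)w=(u,w)v-(v,w)u$. An isothermic surface $(\Lambda,\eta)$ in $S^3$ is an immersion $\Lambda$ with a non-zero closed $1$-form $\eta\in\Omega^1\otimes\mathrm{o}(\mathbb{R}^{4,1})$ taking values in $\Lambda\wedge\Lambda^{\perp}$. Conformal curvature line coordinates $(u,v)$ are coordinates for which $I=e^{2\theta}(\mathrm{d}u^2+\mathrm{d}v^2)$ and $\partial_u,\partial_v$ diagonalise the shape operators; they correspond to $\eta$ when, for any lift $F$ with $(\mathrm{d}F,\mathrm{d}F)=e^{2\theta}(\mathrm{d}u^2+\mathrm{d}v^2)$, $\eta=e^{-2\theta}F\wedge(-F_u\,\mathrm{d}u+F_v\,\mathrm{d}v)$. For $w\ne 0$, $E(w):=\{v\in\mathcal{L}:(v,w)=-1\}$,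 a $3$-dimensional submanifold whose induced metric has constant sectional curvature $-(w,w)$; it is assumed that $\Lambda$ has a lift with values in $E(w)$. A polynomial conserved quantity of $(\Lambda,\eta)$ is a non-zero polynomial $p(t)=\sum_k p_kt^k$ with $p_k\in\Gamma(\underline{\mathbb{R}}^{4,1})$ such that $(\mathrm{d}+t\eta)p(t)=0$ for all $t\in\mathbb R$. $(\Lambda,\eta)$ is special isothermic of type $d$ in the space-form $E(w)$ if it admits a polynomial conserved quantity of degree $d$ with $p_0\in\langle w\rangle$. *)

(* Defs.v *)
From HB Require Import structures.
From mathcomp Require Import all_boot all_order all_algebra.
From mathcomp Require Import all_classical all_reals all_analysis.

Set Implicit Arguments.
Unset Strict Implicit.
Unset Printing Implicit Defensive.

Import Order.TTheory GRing.Theory Num.Theory.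
Import numFieldNormedType.Exports.

Local Open Scope classical_set_scope.
Local Open Scope ring_scope.

(* The surface Sigma carries global coordinates (u, v), so it is identified   *)
(* with their image, an open set U of the plane 'rV[R]_2; index 0 stands for  *)
(* u and index 1 for v.  Functions are total on the plane, but only their     *)
(* values on the open set U matter.                                           *)

Section Calculus.
Variables (R : realType) (V : normedModType R).
Implicit Types (U : set 'rV[R]_2) (f : 'rV[R]_2 -> V).

Definition partial (i : 'I_2) f : 'rV[R]_2 -> V :=
  fun x => 'D_(delta_mx 0 i) f x.

Fixpoint Ck U (k : nat) f : Prop :=
  (forall x, U x -> {for x, continuous f}) /\
  if k is k'.+1 then
    forall i, (forall x, U x -> derivable f x (delta_mx 0 i)) /\
              Ck U k' (partial i f)
  else True.

Definition smooth_on U f : Prop := forall k, Ck U k f.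

End Calculus.

Section Lorentz.
Variable R : realType.
Implicit Types x y : 'rV[R]_5.

Definition lorentz_gram : 'M[R]_5 :=
  diag_mx (\row_i (if i == ord_max then -1 else 1)).

Definition lip x y : R := (x *m lorentz_gram *m y^T) 0 0.

(* Elements of o(4,1) are matrices acting on row vectors from the right; see  *)
(* wedgeE for the action of x /\ y.                                           *)
Definition wedge x y : 'M[R]_5 := lorentz_gram *m (x^T *m y - y^T *m x).

Lemma lipC x y : lip x y = lip y x.
Proof.
rewrite /lip -[LHS]/(_ (0 : 'I_1) (0 : 'I_1)) -[in LHS](trmxK (_ *m y^T)).
by rewrite mxE !trmx_mul trmxK tr_diag_mx mulmxA.
Qed.

Lemma wedgeE x y z : z *m wedge x y = lip x z *: y - lip y z *: x.
Proof.
rewrite /wedge mulmxA mulmxBr !mulmxA (lipC x) (lipC y) -!mul_scalar_mx.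
by rewrite /lip -!mx11_scalar.
Qed.

Definition light_cone : set 'rV[R]_5 := [set x | x != 0 /\ lip x x = 0].

Definition space_form (w : 'rV[R]_5) : set 'rV[R]_5 :=
  [set x | light_cone x /\ lip x w = -1].

End Lorentz.

Section Surfaces.
Variable R : realType.
Implicit Types (U : set 'rV[R]_2) (L : 'rV[R]_2 -> {vspace 'rV[R]_5}).
Implicit Types (F N : 'rV[R]_2 -> 'rV[R]_5) (theta : 'rV[R]_2 -> R).

Definition lift_on U L F : Prop :=
  smooth_on U F /\ forall x, U x -> F x != 0 /\ F x \in L x.

Definition null_line_subbundle U L : Prop :=
  forall x, U x ->
    \dim (L x) = 1%N /\
    (forall v, v \in L x -> lip v v = 0) /\
    (exists V F, [/\ open V, V x, V `<=` U & lift_on V L F]).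

(* The span of F and dF(T Sigma) does not depend on the choice of the lift;   *)
(* L need only have lifts locally.                                            *)
Definition immersion U L : Prop :=
  forall V F, open V -> V `<=` U -> lift_on V L F ->
  forall x, V x ->
    \dim <<[:: F x; partial 0%R F x; partial 1%R F x]>>%VS = 3%N.

(* A 1-form with values in matrices is given by its two components:           *)
(* eta = eta 0 du + eta 1 dv.                                                 *)
Implicit Types eta : 'I_2 -> 'rV[R]_2 -> 'M[R]_5.

Definition closed_form U eta : Prop :=
  forall x, U x -> partial 0 (eta 1) x = partial 1 (eta 0) x.

(* As L x is a line, every element of L x /\ (L x)^perp is decomposable.      *)
Definition in_wedge_perp (l : {vspace 'rV[R]_5}) (A : 'M[R]_5) : Prop :=
  exists f g, [/\ f \in l, forall h, h \in l -> lip h g = 0 & A = wedge f g].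

Definition isothermic U L eta : Prop :=
  null_line_subbundle U L /\ immersion U L /\
  [/\ forall i, smooth_on U (eta i),
      exists i x, U x /\ eta i x != 0,
      closed_form U eta &
      forall i x, U x -> in_wedge_perp (L x) (eta i x)].

Definition first_form F (i j : 'I_2) (x : 'rV[R]_2) : R :=
  lip (partial i F x) (partial j F x).

(* For F with values in E(w) and N normal to F in E(w): the Levi-Civita       *)
(* connection of E(w) is the tangential part of d and N is tangent to E(w),   *)
(* so II(X, Y) = (d_X d_Y F, N).                                              *)
Definition second_form F N (i j : 'I_2) (x : 'rV[R]_2) : R :=
  lip (partial i (partial j F) x) (N x).

(* The tangent space of E(w) at F x is the orthogonal of F x and w.           *)
Definition unit_normal U (w : 'rV[R]_5) F N : Prop :=
  smooth_on U N /\
  forall x, U x ->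
    [/\ lip (N x) (N x) = 1, lip (N x) (F x) = 0, lip (N x) w = 0 &
        forall i, lip (N x) (partial i F x) = 0].

Definition conformal_coordinates U F theta : Prop :=
  forall x, U x -> forall i j,
    first_form F i j x = if i == j then expR (2 * theta x) else 0.

Definition curvature_line_coordinates U F N theta (k1 k2 : 'rV[R]_2 -> R)
    : Prop :=
  forall x, U x ->
    [/\ second_form F N 0 0 x = expR (2 * theta x) * k1 x,
        second_form F N 1 1 x = expR (2 * theta x) * k2 x,
        second_form F N 0 1 x = 0 &
        second_form F N 1 0 x = 0].

Definition coordinates_correspond U L eta : Prop :=
  forall F theta, lift_on U L F -> conformal_coordinates U F theta ->
  forall x, U x ->
    eta 0 x = expR (- 2 * theta x) *: wedge (F x) (- partial 0 F x) /\
    eta 1 x = expR (- 2 * theta x) *: wedge (F x) (partial 1 F x).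

(* Only the coefficients p 0, ..., p d of the sequence p are used.            *)
Definition poly_section (d : nat) (p : nat -> 'rV[R]_2 -> 'rV[R]_5) (t : R)
    : 'rV[R]_2 -> 'rV[R]_5 :=
  fun x => \sum_(k < d.+1) t ^+ k *: p k x.

Definition polynomial_conserved_quantity U eta (d : nat)
    (p : nat -> 'rV[R]_2 -> 'rV[R]_5) : Prop :=
  [/\ forall k, (k <= d)%N -> smooth_on U (p k),
      exists x, U x /\ p d x != 0 &
      forall t i x, U x ->
        partial i (poly_section d p t) x
        + t *: (poly_section d p t x *m eta i x) = 0].

Definition special_isothermic U eta (d : nat) (w : 'rV[R]_5) : Prop :=
  exists p, polynomial_conserved_quantity U eta d p /\
            forall x, U x -> p 0%N x \in <[w]>%VS.

End Surfaces.

(* Main.v *)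
Require Import Defs.
From HB Require Import structures.
From mathcomp Require Import all_boot all_order all_algebra.
From mathcomp Require Import all_classical all_reals all_analysis.
From mathcomp Require Import ring lra.

Set Implicit Arguments.
Unset Strict Implicit.
Unset Printing Implicit Defensive.

Import Order.TTheory GRing.Theory Num.Theory.
Import numFieldNormedType.Exports.

Local Open Scope classical_set_scope.
Local Open Scope ring_scope.

(** Write [E] for the conformal factor of the first fundamental form, [F_u],
    [F_v] for the tangent vectors, and [s] for the sign [-1] in the
    [u]-direction and [+1] in the [v]-direction.  The point [F], the vector
    [w], the unit normal [N] and the tangent vectors form a frame of [R^(4,1)]
    with constant or diagonal Gram matrix ([conformal_frame]); so a vector is
    determined by its five inner products with the frame ([frame_eq]), and its
    norm is an explicit quadratic polynomial in them ([frame_norm]).  The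
    Codazzi equations amount to [L_i = - 2 s_i E H_i] ([pd_skewL]), whence
    [M_i = 2 s_i k_i E H_i] ([pd_prodM]).

    Comparing coefficients in [t], a section [p0 + t p1 + t^2 p2] is conserved
    iff [d p0 = 0], [d p1 = - p0 eta], [d p2 = - p1 eta] and [p2 eta = 0]
    ([conserved2P]).  Let it be conserved, with [p0 = c w].  The last equation
    says [p2 = a N + b F]; the third says that [a] is constant, that [b = a H],
    and that the inner products of [p1] with [F] and with the tangent vectors
    are [- a L / 2] and [s_i a E H_i].  The second equation and the formulas
    for [L_i] and [M_i] say that [(p1, w)], [(p1, N) + a M / 2] and
    [(p1, p1) - 2 c a H] are constant.  Inserting all this into the norm of
    [p1] and dividing by [a^2] gives the differential equation for [H]
    ([special_of_conserved]); [a] vanishes only if [p2] does.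

    Conversely the same inner products, with [a = 1] and the constants of the
    equation, define [p1], and one takes [p2 = N + H F], [p0 = B w].  All
    components of [d p1 + p0 eta] vanish for formal reasons (the Codazzi
    equations and the equality of the mixed derivatives of [L]) except those of
    [p1_u] along [F_u] and of [p1_v] along [F_v].  The differential equation
    now says [(p1, p1) = 2 B H + const], and differentiating it determines the
    two components, because [H_u] and [H_v] do not vanish ([pd_middle]). *)

(** * Mixed derivatives and vanishing derivatives *)

Lemma ord2P (i : 'I_2) : i = 0 \/ i = 1.
Proof. by case: i => [[|[|]]]// ?; [left|right]; apply/val_inj. Qed.

Section MixedPartials.
Variables (R : realType) (V : normedModType R).
Implicit Types (f : V -> R) (U : set V) (x e a b : V).

Lemma is_derive_line f x e s : derivable f (x + s *: e) e ->
  is_derive s 1 (fun t : R => f (x + t *: e)) ('D_e f (x + s *: e)).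
Proof.
move=> df; have E : (fun h : R => h^-1 *: (f (x + (h *: 1 + s) *: e)
    - f (x + s *: e))) = (fun h => h^-1 *: (f (h *: e + (x + s *: e))
    - f (x + s *: e))).
  by apply/funext => h /=; rewrite [h%:A]mulr1 scalerDl addrCA.
by apply: DeriveDef; [rewrite /derivable E|rewrite /derive E].
Qed.

Lemma is_derive_translate f x c e : derivable f (x + c) e ->
  is_derive x e (fun y => f (y + c)) ('D_e f (x + c)).
Proof.
move=> df; have E : (fun h : R => h^-1 *: (f (h *: e + x + c) - f (x + c)))
    = (fun h => h^-1 *: (f (h *: e + (x + c)) - f (x + c))).
  by apply/funext => h; rewrite addrA.
by apply: DeriveDef; [rewrite /derivable E|rewrite /derive E].
Qed.

Lemma mvt_line f x e h : 0 <= h ->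
  (forall s, 0 <= s <= h -> derivable f (x + s *: e) e) ->
  exists2 c, 0 <= c <= h & f (x + h *: e) - f x = h * 'D_e f (x + c *: e).
Proof.
move=> h0 df.
have [s sI||c cI] := @MVT_segment R (fun t => f (x + t *: e))
    (fun t => 'D_e f (x + t *: e)) 0 h h0.
- by apply/is_derive_line/df; move: sI; rewrite in_itv /= => /andP[/ltW-> /ltW->].
- apply: derivable_within_continuous => s; rewrite in_itv /= => sI.
  by have [] := is_derive_line (df s sI).
by rewrite scale0r addr0 subr0 mulrC => E; exists c => //; move: cI; rewrite in_itv.
Qed.

Lemma ball_comb x a b d : 0 < d -> exists2 h : R, 0 < h &
  forall s t, `|s| <= h -> `|t| <= h -> ball x d (x + s *: a + t *: b).
Proof.
move=> d0; have n0 : 0 < `|a| + `|b| + 1 by rewrite ltr_wpDl ?addr_ge0.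
exists (d / (`|a| + `|b| + 1)); first by rewrite divr_gt0.
move=> s t sh th; rewrite -ball_normE /ball_ /= -addrA opprD addNKr normrN.
apply: (le_lt_trans (ler_normD _ _)); rewrite !normrZ.
apply: (@le_lt_trans _ _ (d / (`|a| + `|b| + 1) * (`|a| + `|b|))).
  by rewrite mulrDr lerD// ler_wpM2r.
by rewrite mulrAC ltr_pdivrMr// ltr_pM2l// ltrDl.
Qed.

(** The mean value theorem in direction [a], for [y |-> f (y + h b) - f y],
    and then in direction [b], for the derivative of [f] along [a]. *)
Lemma second_difference f U x a b d h : ball x d `<=` U -> 0 < h ->
  (forall s t, `|s| <= h -> `|t| <= h -> ball x d (x + s *: a + t *: b)) ->
  (forall y, U y -> derivable f y a) ->
  (forall y, U y -> derivable ('D_a f) y b) ->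
  exists2 y, ball x d y &
    f (x + h *: a + h *: b) - f (x + h *: a) - f (x + h *: b) + f x
    = h ^+ 2 * 'D_b ('D_a f) y.
Proof.
move=> dU h0 hball dfa dfab.
pose g y := f (y + h *: b) - f y.
have nh : `|h| <= h by rewrite gtr0_norm.
have n0 : `|0 : R| <= h by rewrite normr0 ltW.
have ns s : 0 <= s <= h -> `|s| <= h by move=> /andP[s0 sh]; rewrite ger0_norm.
have inU s t : `|s| <= h -> `|t| <= h -> U (x + s *: a + t *: b).
  by move=> sh th; apply/dU/hball.
have D1 s : 0 <= s <= h -> is_derive (x + s *: a) a (fun y => f (y + h *: b))
    ('D_a f (x + s *: a + h *: b)).
  by move=> /ns sh; apply/is_derive_translate/dfa/inU.
have D2 s : 0 <= s <= h -> derivable f (x + s *: a) a.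
  move=> /ns sh; have := dfa _ (inU s 0 sh n0).
  by rewrite scale0r addr0.
have [s sI gE] := @mvt_line g x a h (ltW h0) (fun s sI =>
  derivableB (@ex_derive _ _ _ _ _ _ _ (D1 s sI)) (D2 s sI)).
have DE : 'D_a g (x + s *: a) = 'D_a f (x + s *: a + h *: b) - 'D_a f (x + s *: a).
  have D1s := D1 s sI.
  by rewrite /g deriveB ?derive_val//; apply: D2.
have [t tI fE] := @mvt_line ('D_a f) (x + s *: a) b h (ltW h0)
   (fun t tI => dfab _ (inU s t (ns s sI) (ns t tI))).
exists (x + s *: a + t *: b); first by apply: hball; apply: ns.
rewrite expr2 -mulrA -fE -DE -gE /g; ring.
Qed.

Lemma eq_of_close_values (g h : V -> R) x :
  {for x, continuous g} -> {for x, continuous h} ->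
  (forall d, 0 < d -> exists y z, [/\ ball x d y, ball x d z & g y = h z]) ->
  g x = h x.
Proof.
move=> gc hc gh; apply/eqP/negPn/negP => neq.
pose eps := `|g x - h x| / 2.
have e0 : 0 < eps by rewrite divr_gt0// normr_gt0 subr_eq0.
have /cvgrPdist_lt/(_ _ e0) nG := gc; have /cvgrPdist_lt/(_ _ e0) nH := hc.
have /nbhs_ballP[d /= d0 dP] : nbhs x ([set y | `|g x - g y| < eps] `&`
    [set y | `|h x - h y| < eps]) by apply: filterI nG nH.
have [y [z [/dP[/= gy _] /dP[/= _ hz] gyhz]]] := gh d d0.
have : `|g x - h x| < eps + eps.
  have -> : g x - h x = (g x - g y) - (h x - h z) by rewrite gyhz; ring.
  by rewrite (le_lt_trans (ler_normB _ _))// ltrD.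
by rewrite /eps -splitr ltxx.
Qed.

(** Schwarz's theorem: the second difference of [f] on a small parallelogram
    is, by the mean value theorem applied twice, a value near [x] of either
    mixed derivative. *)
Lemma derive_comm f U x a b : open U -> U x ->
  (forall y, U y -> derivable f y a) ->
  (forall y, U y -> derivable f y b) ->
  (forall y, U y -> derivable ('D_a f) y b) ->
  (forall y, U y -> derivable ('D_b f) y a) ->
  {for x, continuous ('D_b ('D_a f))} ->
  {for x, continuous ('D_a ('D_b f))} ->
  'D_b ('D_a f) x = 'D_a ('D_b f) x.
Proof.
move=> oU Ux dfa dfb dfab dfba cab cba.
apply: eq_of_close_values cab cba _ => r r0.
have nU : nbhs x U by apply: open_nbhs_nbhs.
have /nbhs_ballP[d /= d0 dP] : nbhs x (U `&` ball x r).
  by apply: filterI nU _; apply: nbhsx_ballx.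
have [h h0 hball] := ball_comb x a b d0.
have dU : ball x d `<=` U by move=> y /dP[].
have [y /dP[_ yr] yE] := second_difference dU h0 hball dfa dfab.
have [|z /dP[_ zr] zE] := @second_difference f U x b a d h dU h0 _ dfb dfba.
  by move=> s t sh th; rewrite addrAC; apply: hball.
exists y, z; split; [exact: yr|exact: zr|].
apply: (@mulfI _ (h ^+ 2)); first by rewrite expf_neq0// gt_eqF.
rewrite -[LHS]yE -[RHS]zE [x + h *: b + _]addrAC.
by rewrite [f _ - f (x + h *: b) - _]addrAC.
Qed.

Lemma derive0_line f U x a h : (forall s, `|s| <= `|h| -> U (x + s *: a)) ->
  (forall y, U y -> derivable f y a) -> (forall y, U y -> 'D_a f y = 0) ->
  f (x + h *: a) = f x.
Proof.
move=> inU df f0.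
have [h0|h0] := leP 0 h.
  have [s /andP[s0 sh]|c /andP[c0 ch]] := @mvt_line f x a h h0.
    by apply/df/inU; rewrite !ger0_norm.
  rewrite f0 ?mulr0; last by apply: inU; rewrite !ger0_norm.
  by move/eqP; rewrite subr_eq0 => /eqP.
have aux c : 0 <= c <= - h -> `|h + c| <= `|h|.
  by move=> /andP[c0 ch]; rewrite (ltr0_norm h0) ler0_norm; lra.
have mh : 0 <= - h by rewrite oppr_ge0 ltW.
have [s sI|c cI] := @mvt_line f (x + h *: a) a (- h) mh.
  by rewrite -addrA -scalerDl; apply/df/inU/aux.
rewrite -!addrA -!scalerDl subrr scale0r addr0 f0 ?mulr0; last exact/inU/aux.
by move/eqP; rewrite subr_eq0 => /eqP.
Qed.

End MixedPartials.

(** Level sets are open in [U] because [f] is constant along coordinate paths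
    inside small balls; so they are also relatively closed. *)
Lemma partials0_constant (R : realType) (U : set 'rV[R]_2) (f : 'rV[R]_2 -> R) :
  open U -> connected U ->
  (forall i x, U x -> derivable f x (delta_mx 0 i)) ->
  (forall i x, U x -> partial i f x = 0) ->
  forall x y, U x -> U y -> f x = f y.
Proof.
move=> oU cU df f0 x y Ux Uy.
pose e i : 'rV[R]_2 := delta_mx 0 i.
(* z' is reached from z by one step in each coordinate direction *)
have loc z : U z -> \forall z' \near z, U z' /\ f z' = f z.
  move=> Uz; have /nbhs_ballP[d /= d0 dU] : nbhs z U by apply: open_nbhs_nbhs.
  have [h h0 hball] := ball_comb z (e 0) (e 1) d0.
  apply/nbhs_ballP; exists h => //= z' zz'.
  have co i : `|(z' - z) 0 i| <= h.
    move: zz'; rewrite -ball_normE /ball_ /= distrC => /ltW; apply: le_trans.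
    rewrite [leRHS]/Num.Def.normr/= mx_normrE.
    exact: (@le_bigmax _ _ _ _ (fun ij => `|(z' - z) ij.1 ij.2|) (0, i)).
  have z'E : z' = z + (z' - z) 0 0 *: e 0 + (z' - z) 0 1 *: e 1.
    apply/rowP => i; rewrite !mxE !eqxx /=.
    have [->|->] := ord2P i.
      by rewrite /= mulr1 mulr0; ring.
    by rewrite /= mulr1 mulr0; ring.
  set s := (z' - z) 0 0 in z'E; set t := (z' - z) 0 1 in z'E.
  have sh : `|s| <= h := co 0; have th : `|t| <= h := co 1.
  have n0 : `|0 : R| <= h by rewrite normr0 ltW.
  split; first by rewrite z'E; apply/dU/hball.
  have f1 : f (z + s *: e 0) = f z.
    apply: (@derive0_line _ _ _ U) => [u us|w Uw|w Uw]; [|exact: df|exact: f0].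
    have := hball u 0 (le_trans us sh) n0.
    by rewrite scale0r addr0 => /dU.
  rewrite z'E -f1.
  apply: (@derive0_line _ _ _ U) => [u us|w Uw|w Uw]; [|exact: df|exact: f0].
  exact/dU/hball/(le_trans us).
have B : [set z | U z /\ f z = f x] = U; last first.
  by have [] : [set z | U z /\ f z = f x] y by rewrite B.
apply: cU; first by exists x.
  exists [set z | U z /\ f z = f x]; last by apply/seteqP; split=> z /= [] // ? [].
  rewrite openE => z [Uz fz]; apply: filterS (loc z Uz) => z' [Uz' fz'].
  by split=> //; rewrite fz'.
exists (~` [set z | U z /\ f z != f x]).
  apply/open_closedC; rewrite openE => z [Uz fz].
  by apply: filterS (loc z Uz) => z' [Uz' fz']; split=> //; rewrite fz'.
apply/seteqP; split=> z /= [Uz].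
  by move=> fz; split=> // -[_]; rewrite fz eqxx.
by move=> nz; split=> //; apply/eqP/negPn/negP => fz; apply: nz.
Qed.

(** * Closure properties of smooth functions *)

Section CkClosure.
Variables (R : realType) (V : normedModType R) (U : set 'rV[R]_2).
Hypothesis oU : open U.
Implicit Types f g : 'rV[R]_2 -> V.

Lemma near_of_eq_on f g x : (forall y, U y -> f y = g y) -> U x ->
  \forall y \near x, f y = g y.
Proof. by move=> fg Ux; apply: filterS fg _; apply: open_nbhs_nbhs. Qed.

Lemma partial_congr i f g x : (forall y, U y -> f y = g y) -> U x ->
  partial i f x = partial i g x.
Proof. by move=> fg Ux; apply: near_eq_derive; apply: near_of_eq_on. Qed.

Lemma continuous_congr f g x : (forall y, U y -> f y = g y) -> U x ->
  {for x, continuous f} -> {for x, continuous g}.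
Proof.
move=> fg Ux fc; rewrite /prop_for /continuous_at -(fg _ Ux).
apply: cvg_trans fc; apply: (@near_eq_cvg _ _ (nbhs x)).
exact: near_of_eq_on.
Qed.

Lemma Ck_congr k f g : (forall y, U y -> f y = g y) -> Ck U k f -> Ck U k g.
Proof.
elim: k f g => [|k IH] f g fg [fc fk].
  by split=> // x Ux; apply: continuous_congr fg Ux (fc x Ux).
split=> [x Ux|i]; first exact: continuous_congr fg Ux (fc x Ux).
have [df pf] := fk i; split=> [x Ux|].
  by apply: near_eq_derivable (df x Ux); apply: near_of_eq_on.
by apply: IH pf => x Ux; apply: partial_congr.
Qed.

Lemma CkS k f : Ck U k.+1 f -> Ck U k f.
Proof.
elim: k f => [|k IH] f [fc fk]; split=> // i.
by have [df pf] := fk i; split=> //; apply: IH.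
Qed.

Lemma Ck_cst k (c : V) : Ck U k (fun=> c).
Proof.
elim: k c => [|k IH] c; (split; first by move=> x _; exact: cst_continuous) => // i.
split=> [x _|]; first exact: derivable_cst.
by apply: Ck_congr (IH 0) => x _; rewrite /partial derive_cst.
Qed.

Lemma CkD k f g : Ck U k f -> Ck U k g -> Ck U k (fun x => f x + g x).
Proof.
elim: k f g => [|k IH] f g [fc fk] [gc gk].
  by split=> // x Ux; apply: continuousD; [exact: fc|exact: gc].
split=> [x Ux|i]; first by apply: continuousD; [exact: fc|exact: gc].
have [[df pf] [dg pg]] := (fk i, gk i); split=> [x Ux|].
  by apply: derivableD; [exact: df|exact: dg].
apply: Ck_congr (IH _ _ pf pg) => x Ux; rewrite /partial.
by rewrite (deriveD (df x Ux) (dg x Ux)).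
Qed.

Lemma smooth_congr f g : (forall y, U y -> f y = g y) ->
  smooth_on U f -> smooth_on U g.
Proof. by move=> fg sf k; apply: Ck_congr fg (sf k). Qed.

Lemma smooth_cst (c : V) : smooth_on U (fun=> c).
Proof. by move=> k; apply: Ck_cst. Qed.

Lemma smoothD f g : smooth_on U f -> smooth_on U g ->
  smooth_on U (fun x => f x + g x).
Proof. by move=> sf sg k; apply: CkD. Qed.

Lemma smooth_derivable f i x : smooth_on U f -> U x ->
  derivable f x (delta_mx 0 i).
Proof. by move=> sf Ux; have [_ /(_ i)[+ _]] := sf 1%N; apply. Qed.

Lemma smooth_partial f i : smooth_on U f -> smooth_on U (partial i f).
Proof. by move=> sf k; have [_ /(_ i)[]] := sf k.+1. Qed.

Lemma smooth_continuous f x : smooth_on U f -> U x -> {for x, continuous f}.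
Proof. by move=> sf Ux; have [+ _] := sf 0%N; apply. Qed.

End CkClosure.

Section CkProducts.
Variables (R : realType) (U : set 'rV[R]_2).
Hypothesis oU : open U.
Implicit Types f g : 'rV[R]_2 -> R.

Lemma CkM k f g : Ck U k f -> Ck U k g -> Ck U k (fun x => f x * g x).
Proof.
elim: k f g => [|k IH] f g fk gk; have [fc f1] := fk; have [gc g1] := gk.
  by split=> // x Ux; apply: continuousM; [exact: fc|exact: gc].
split=> [x Ux|i]; first by apply: continuousM; [exact: fc|exact: gc].
have [[df pf] [dg pg]] := (f1 i, g1 i); split=> [x Ux|].
  by apply: derivableM; [exact: df|exact: dg].
have := CkD oU (IH _ _ (CkS fk) pg) (IH _ _ (CkS gk) pf).
apply: Ck_congr => // x Ux; rewrite /partial.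
by rewrite (deriveM (df x Ux) (dg x Ux)).
Qed.

(** The derivative of [1 / f] is a product of [f'] and powers of [1 / f], which
    are as smooth as needed by induction. *)
Lemma CkV k f : (forall x, U x -> f x != 0) ->
  Ck U k f -> Ck U k (fun x => (f x)^-1).
Proof.
move=> f0; elim: k => [|k IH] fk; have [fc f1] := fk.
  by split=> // x Ux; apply: continuousV; [exact: f0|exact: fc].
split=> [x Ux|i]; first by apply: continuousV; [exact: f0|exact: fc].
have [df pf] := f1 i; split=> [x Ux|]; first exact: derivableV (f0 x Ux) (df x Ux).
have IV := IH (CkS fk).
have := CkM (CkM (Ck_cst oU k (- 1 : R)) (CkM IV IV)) pf.
apply: Ck_congr => // x Ux; rewrite /partial.
by rewrite (deriveV (f0 x Ux) (df x Ux)) mulN1r expr2 invfM.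
Qed.

Lemma smoothM f g : smooth_on U f -> smooth_on U g ->
  smooth_on U (fun x => f x * g x).
Proof. by move=> sf sg k; apply: CkM. Qed.

Lemma smoothV f : (forall x, U x -> f x != 0) -> smooth_on U f ->
  smooth_on U (fun x => (f x)^-1).
Proof. by move=> f0 sf k; apply: CkV. Qed.

Lemma smoothN f : smooth_on U f -> smooth_on U (fun x => - f x).
Proof.
move=> sf; apply: smooth_congr (smoothM (smooth_cst oU (- 1 : R)) sf) => // x _.
by rewrite mulN1r.
Qed.

End CkProducts.

Lemma continuous_coord (R : realType) (T : topologicalType) n
    (f : T -> 'rV[R]_n) x :
  {for x, continuous f} <-> forall j, {for x, continuous (fun y => f y 0 j)}.
Proof.
split=> [fc j|fc].
  exact: (@continuous_comp _ _ _ f (fun M : 'rV[R]_n => M 0 j) x fc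
    (@coord_continuous _ _ _ 0 j (f x))).
apply/cvgrPdist_le => e e0; near=> y.
rewrite [leLHS]/Num.Def.normr/= mx_normrE (bigmax_le _ (ltW e0))//= => -[i j] _.
rewrite ord1 !mxE /=; move: j {i}; near: y; apply: filter_forall => j.
by have /cvgrPdist_le := fc j; apply.
Unshelve. all: by end_near. Qed.

Section CkCoordinates.
Variables (R : realType) (U : set 'rV[R]_2).
Hypothesis oU : open U.
Variable n : nat.
Implicit Types f g : 'rV[R]_2 -> 'rV[R]_n.

Lemma derivable_partial_coord i f x j : derivable f x (delta_mx 0 i) ->
  partial i f x 0 j = partial i (fun y => f y 0 j) x.
Proof. by move=> df; rewrite /partial derive_mx// mxE. Qed.

(** Continuity, differentiability and derivatives of row vectors are computed
    entrywise, which reduces smoothness of vectors to that of scalars. *)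
Lemma Ck_coord k f : Ck U k f <-> forall j, Ck U k (fun x => f x 0 j).
Proof.
elim: k f => [|k IH] f.
  split=> [[fc _] j|fc]; split=> // x Ux.
    by move: j; apply/continuous_coord/fc.
  by apply/continuous_coord => j; have [+ _] := fc j; apply.
split=> [[fc fk] j|fk]; split=> [x Ux|i].
- by move: j; apply/continuous_coord/fc.
- have [df /IH/(_ j) pf] := fk i; split=> [x Ux|].
    by have /derivable_mxP := df x Ux; apply.
  by apply: Ck_congr pf => // x Ux; rewrite derivable_partial_coord//; apply: df.
- by apply/continuous_coord => j; have [+ _] := fk j; apply.
- have df x : U x -> derivable f x (delta_mx 0 i).
    move=> Ux; apply/derivable_mxP => a j; rewrite ord1.
    by have [_ /(_ i)[+ _]] := fk j; apply.
  split=> //; apply/IH => j; have [_ /(_ i)[_]] := fk j.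
  by apply: Ck_congr => // x Ux; rewrite derivable_partial_coord//; apply: df.
Qed.

Lemma smooth_coord f :
  smooth_on U f <-> forall j, smooth_on U (fun x => f x 0 j).
Proof.
split=> [sf j k|sf k]; first by move: j; apply/Ck_coord.
by apply/Ck_coord => j; apply: sf.
Qed.

Lemma smoothZ (a : 'rV[R]_2 -> R) f : smooth_on U a -> smooth_on U f ->
  smooth_on U (fun x => a x *: f x).
Proof.
move=> sa /smooth_coord sf; apply/smooth_coord => j.
by apply: smooth_congr (smoothM oU sa (sf j)) => // x _; rewrite mxE.
Qed.

End CkCoordinates.

(** * Rules for partial derivatives *)

(** Partial derivatives, locked: the sequel uses them only through the rules
    below, and comparing two of them by unfolding limits is intractable. *)
Definition pd (R : realType) (V : normedModType R) := locked (@partial R V).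

Lemma pdE (R : realType) (V : normedModType R) : @pd R V = @partial R V.
Proof. by rewrite /pd -lock. Qed.

Section DerivativeRules.
Variables (R : realType) (U : set 'rV[R]_2).
Hypothesis oU : open U.

Section AnyTarget.
Variable V : normedModType R.
Implicit Types f g : 'rV[R]_2 -> V.

Lemma smooth_pd i f : smooth_on U f -> smooth_on U (pd i f).
Proof. by rewrite pdE; apply: smooth_partial. Qed.

Lemma pd_congr i f g x : (forall y, U y -> f y = g y) -> U x ->
  pd i f x = pd i g x.
Proof. by rewrite pdE; apply: partial_congr. Qed.

Lemma pd_cst i (c : V) x : pd i (fun=> c) x = 0.
Proof. by rewrite pdE; apply: derive_cst. Qed.

Lemma pdD i f g x : smooth_on U f -> smooth_on U g -> U x ->
  pd i (fun y => f y + g y) x = pd i f x + pd i g x.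
Proof.
move=> sf sg Ux; rewrite pdE /partial.
by rewrite (deriveD (smooth_derivable sf Ux) (smooth_derivable sg Ux)).
Qed.

End AnyTarget.

Section ScalarFunctions.
Implicit Types f g : 'rV[R]_2 -> R.

Lemma pdM i f g x : smooth_on U f -> smooth_on U g -> U x ->
  pd i (fun y => f y * g y) x = pd i f x * g x + f x * pd i g x.
Proof.
move=> sf sg Ux; rewrite addrC [pd i f x * _]mulrC pdE /partial.
by rewrite (deriveM (smooth_derivable sf Ux) (smooth_derivable sg Ux)).
Qed.

Lemma pdZ i (c : R) f x : smooth_on U f -> U x ->
  pd i (fun y => c * f y) x = c * pd i f x.
Proof.
move=> sf Ux; rewrite (pdM i (smooth_cst oU c) sf Ux) pd_cst.
by rewrite mul0r add0r.
Qed.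

Lemma pdN i f x : smooth_on U f -> U x -> pd i (fun y => - f y) x = - pd i f x.
Proof.
move=> sf Ux; rewrite pdE /partial.
by rewrite (deriveN (smooth_derivable sf Ux)).
Qed.

Lemma pdC i j f x : smooth_on U f -> U x -> pd i (pd j f) x = pd j (pd i f) x.
Proof.
move=> sf Ux; rewrite !pdE; apply: (derive_comm oU Ux).
- by move=> y; apply: smooth_derivable.
- by move=> y; apply: smooth_derivable.
- by move=> y; apply: smooth_derivable; apply: smooth_partial.
- by move=> y; apply: smooth_derivable; apply: smooth_partial.
- exact: (smooth_continuous (smooth_partial i (smooth_partial j sf)) Ux).
- exact: (smooth_continuous (smooth_partial j (smooth_partial i sf)) Ux).
Qed.

Lemma pd0_constant f : connected U -> smooth_on U f ->
  (forall i x, U x -> pd i f x = 0) -> forall x y, U x -> U y -> f x = f y.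
Proof.
rewrite pdE => cU sf f0; apply: partials0_constant oU cU _ f0 => i x.
exact: smooth_derivable.
Qed.

End ScalarFunctions.

Section VectorFunctions.
Variable n : nat.
Implicit Types f g : 'rV[R]_2 -> 'rV[R]_n.

Lemma pd_coord i f x j : smooth_on U f -> U x ->
  pd i f x 0 j = pd i (fun y => f y 0 j) x.
Proof.
by move=> sf Ux; rewrite !pdE; apply/derivable_partial_coord/smooth_derivable/Ux.
Qed.

Lemma pd_scale i (a : 'rV[R]_2 -> R) f x :
  smooth_on U a -> smooth_on U f -> U x ->
  pd i (fun y => a y *: f y) x = pd i a x *: f x + a x *: pd i f x.
Proof.
move=> sa sf Ux; have sj j := (smooth_coord oU f).1 sf j.
apply/rowP => j; rewrite (pd_coord i j (smoothZ oU sa sf) Ux) !mxE.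
rewrite (pd_coord i j sf Ux) -(pdM i sa (sj j) Ux).
by apply: pd_congr Ux => y _; rewrite mxE.
Qed.

Lemma vec_pdC i j f x : smooth_on U f -> U x -> pd i (pd j f) x = pd j (pd i f) x.
Proof.
move=> sf Ux; have sk k := (smooth_coord oU f).1 sf k.
apply/rowP => k.
rewrite [LHS](pd_coord i k (smooth_pd j sf) Ux).
rewrite [RHS](pd_coord j k (smooth_pd i sf) Ux).
have E a : forall y, U y -> pd a f y 0 k = pd a (fun z => f z 0 k) y.
  by move=> y Uy; apply: pd_coord sf Uy.
rewrite [LHS](pd_congr i (E j) Ux) [RHS](pd_congr j (E i) Ux).
exact: (pdC _ _ (sk k) Ux).
Qed.

Lemma vec_pd0_constant f : connected U -> smooth_on U f ->
  (forall i x, U x -> pd i f x = 0) -> forall x y, U x -> U y -> f x = f y.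
Proof.
move=> cU sf f0 x y Ux Uy; apply/rowP => j.
apply: (pd0_constant cU ((smooth_coord oU f).1 sf j)) => // i z Uz.
by rewrite -(pd_coord i j sf Uz) f0// mxE.
Qed.

End VectorFunctions.

Section LorentzFunctions.
Implicit Types f g : 'rV[R]_2 -> 'rV[R]_5.

Lemma smooth_poly_section d (p : nat -> 'rV[R]_2 -> 'rV[R]_5) t :
  (forall k, (k <= d)%N -> smooth_on U (p k)) -> smooth_on U (poly_section d p t).
Proof.
elim: d => [|d IH] sp.
  apply: smooth_congr (sp 0%N isT) => // x _.
  by rewrite /poly_section big_ord1 expr0 scale1r.
apply: smooth_congr (smoothD oU (IH _)
  (smoothZ oU (smooth_cst oU (t ^+ d.+1)) (sp d.+1 (leqnn _)))) => //.
  by move=> x _; rewrite /poly_section [RHS]big_ord_recr.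
by move=> k kd; apply/sp/leqW.
Qed.

Lemma pd_poly_section i d (p : nat -> 'rV[R]_2 -> 'rV[R]_5) t x :
  (forall k, (k <= d)%N -> smooth_on U (p k)) -> U x ->
  pd i (poly_section d p t) x = poly_section d (fun k => pd i (p k)) t x.
Proof.
move=> + Ux; elim: d => [|d IH] sp.
  rewrite [RHS]/poly_section big_ord1 expr0 scale1r.
  apply: pd_congr Ux => // y _.
  by rewrite /poly_section big_ord1 expr0 scale1r.
have sp' k : (k <= d)%N -> smooth_on U (p k) by move=> kd; apply/sp/leqW.
have sd := sp d.+1 (leqnn _); have st := smooth_cst oU (t ^+ d.+1).
rewrite [RHS]/poly_section big_ord_recr /=.
transitivity (pd i (poly_section d p t) x + t ^+ d.+1 *: pd i (p d.+1) x);
  last by rewrite (IH sp').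
have E y : U y -> poly_section d.+1 p t y =
    poly_section d p t y + t ^+ d.+1 *: p d.+1 y.
  by move=> _; rewrite /poly_section big_ord_recr.
rewrite [LHS](pd_congr i E Ux).
rewrite (pdD i (smooth_poly_section t sp') (smoothZ oU st sd) Ux).
by rewrite (pd_scale i st sd Ux) pd_cst scale0r add0r.
Qed.

Lemma lip_sum (x y : 'rV[R]_5) : lip x y =
  x 0 0 * y 0 0 + x 0 1 * y 0 1 + x 0 2%:R * y 0 2%:R + x 0 3%:R * y 0 3%:R
  - x 0 4%:R * y 0 4%:R.
Proof.
rewrite /lip /lorentz_gram mul_mx_diag mxE !big_ord_recl big_ord0 !mxE /=.
rewrite addr0 !mulr1 mulrN1 mulNr !addrA.
by congr (_ + _ + _ + _ - _); congr (x 0 _ * y 0 _); apply/val_inj.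
Qed.

Lemma smooth_lip f g : smooth_on U f -> smooth_on U g ->
  smooth_on U (fun x => lip (f x) (g x)).
Proof.
move=> /(smooth_coord oU) sf /(smooth_coord oU) sg.
have s j := smoothM oU (sf j) (sg j).
have := smoothD oU (smoothD oU (smoothD oU (smoothD oU (s 0) (s 1)) (s 2%:R))
  (s 3%:R)) (smoothN oU (s 4%:R)).
by apply: smooth_congr => // x _; rewrite lip_sum.
Qed.

Lemma pd_lip i f g x : smooth_on U f -> smooth_on U g -> U x ->
  pd i (fun y => lip (f y) (g y)) x = lip (pd i f x) (g x) + lip (f x) (pd i g x).
Proof.
move=> sf sg Ux.
have sfj := (smooth_coord oU f).1 sf; have sgj := (smooth_coord oU g).1 sg.
have s j := smoothM oU (sfj j) (sgj j).
have E y : U y -> lip (f y) (g y) = _ := fun _ => lip_sum (f y) (g y).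
rewrite (pd_congr i E Ux).
have sN := smoothN oU (s 4%:R).
have s1 := smoothD oU (s 0) (s 1); have s2 := smoothD oU s1 (s 2%:R).
have s3 := smoothD oU s2 (s 3%:R).
rewrite (pdD i s3 sN Ux) (pdN i (s 4%:R) Ux) (pdD i s2 (s 3%:R) Ux).
rewrite (pdD i s1 (s 2%:R) Ux) (pdD i (s 0) (s 1) Ux).
rewrite !(fun j => pdM i (sfj j) (sgj j) Ux).
rewrite -!(fun j => pd_coord i j sf Ux) -!(fun j => pd_coord i j sg Ux).
by rewrite !lip_sum; ring.
Qed.

(** Leibniz's rule in the form used to find the components of a derivative
    from known inner products. *)
Lemma pd_lip_eq i f g (h : 'rV[R]_2 -> R) x :
  smooth_on U f -> smooth_on U g ->
  (forall y, U y -> lip (f y) (g y) = h y) -> U x ->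
  lip (pd i f x) (g x) = pd i h x - lip (f x) (pd i g x).
Proof.
by move=> sf sg fgh Ux; rewrite -(pd_congr i fgh Ux) (pd_lip i sf sg Ux) addrK.
Qed.

End LorentzFunctions.

End DerivativeRules.

(** * The Lorentz product and conformal frames *)

Section LorentzAlgebra.
Variable R : realType.
Implicit Types (x y z v : 'rV[R]_5) (a : R).

Lemma lipDl x y z : lip (x + y) z = lip x z + lip y z.
Proof. by rewrite /lip !mulmxDl mxE. Qed.

Lemma lipZl a x z : lip (a *: x) z = a * lip x z.
Proof. by rewrite /lip -!scalemxAl mxE. Qed.

Lemma lipDr x y z : lip z (x + y) = lip z x + lip z y.
Proof. by rewrite lipC lipDl !(lipC _ z). Qed.

Lemma lipZr a x z : lip z (a *: x) = a * lip z x.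
Proof. by rewrite lipC lipZl (lipC x). Qed.

Lemma lip0l z : lip 0 z = 0.
Proof. by rewrite -(scale0r (0 : 'rV[R]_5)) lipZl mul0r. Qed.

Lemma lip0r z : lip z 0 = 0.
Proof. by rewrite lipC lip0l. Qed.

Lemma lipNl x z : lip (- x) z = - lip x z.
Proof. by rewrite -scaleN1r lipZl mulN1r. Qed.

Lemma lipNr x z : lip z (- x) = - lip z x.
Proof. by rewrite lipC lipNl lipC. Qed.

Definition lipE := (lipDl, lipDr, lipNl, lipNr, lipZl, lipZr).

(** The Gram relations of the frame formed by a point [f] of the space form
    [E(w)], a unit normal [n] and conformal tangent vectors [e 0], [e 1]. *)
Definition conformal_frame (w f n : 'rV[R]_5) (e : 'I_2 -> 'rV[R]_5) (E : R) :=
  [/\ lip f f = 0, lip f w = -1, E != 0 &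
   [/\ lip n n = 1, lip n f = 0 & lip n w = 0] /\
   [/\ forall i, lip n (e i) = 0, forall i, lip f (e i) = 0,
       forall i, lip (e i) w = 0 &
       forall i j, lip (e i) (e j) = if i == j then E else 0]].

Lemma lorentz_gram_unit : lorentz_gram R \in unitmx.
Proof.
rewrite unitmxE det_diag unitfE; apply/prodf_neq0 => i _.
by rewrite mxE; case: ifP; rewrite ?oner_eq0// oppr_eq0 oner_eq0.
Qed.

(** The Gram matrix of the frame is nondegenerate, so its five vectors form a
    basis, and a vector orthogonal to a basis is zero. *)
Lemma frame_inj w f n e E v : conformal_frame w f n e E ->
  lip v f = 0 -> lip v w = 0 -> lip v n = 0 -> (forall i, lip v (e i) = 0) ->
  v = 0.
Proof.
move=> [ff fw E0 [[nn nf nw] [ne fe ew ee]]] vf vw vn ve.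
pose B : 'M[R]_5 := \matrix_(i < 5) [:: f; w; n; e 0; e 1]`_i.
have B_unit : B \in unitmx.
  rewrite -row_free_unit -kermx_eq0; apply/rowV0P => c.
  rewrite sub_kermx mulmx_sum_row !big_ord_recl big_ord0 !rowK /= addr0 => /eqP c0.
  set a0 := c 0 _ in c0 *; set a1 := c 0 _ in c0 *; set a2 := c 0 _ in c0 *.
  set a3 := c 0 _ in c0 *; set a4 := c 0 _ in c0 *.
  have c0z z : lip (a0 *: f + (a1 *: w + (a2 *: n + (a3 *: e 0 + a4 *: e 1)))) z = 0.
    by rewrite c0 lip0l.
  have e1_0 : a1 = 0.
    by have := c0z f; rewrite !lipE ff nf (lipC w) fw !(lipC (e _)) !fe; lra.
  have e0_0 : a0 = 0.
    by have := c0z w; rewrite !lipE e1_0 fw nw !ew; lra.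
  have e2_0 : a2 = 0.
    have := c0z n; rewrite !lipE nn (lipC f) nf (lipC w) nw !(lipC (e _)) !ne; lra.
  have ez i : a3 * lip (e 0) (e i) + a4 * lip (e 1) (e i) = 0.
    by have := c0z (e i); rewrite !lipE fe ne (lipC w) ew; lra.
  have e3_0 : a3 = 0.
    by apply: (mulIf E0); have := ez 0; rewrite !ee /= mulr0 addr0 mul0r.
  have e4_0 : a4 = 0.
    by apply: (mulIf E0); have := ez 1; rewrite !ee /= mulr0 add0r mul0r.
  apply/rowP => i; rewrite [RHS]mxE.
  by case: i => [[|[|[|[|[|]]]]]]// h; [rewrite -[RHS]e0_0|rewrite -[RHS]e1_0|
    rewrite -[RHS]e2_0|rewrite -[RHS]e3_0|rewrite -[RHS]e4_0];
    congr (c 0 _); apply/val_inj.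
have JB_unit : lorentz_gram R *m B^T \in unitmx.
  by rewrite unitmx_mul lorentz_gram_unit unitmx_tr.
apply: (can_inj (mulmxK JB_unit)); rewrite mul0mx mulmxA.
apply/rowP => i; rewrite [RHS]mxE.
have -> : (v *m lorentz_gram R *m B^T) 0 i = lip v (row i B).
  by rewrite /lip !mxE; apply: eq_bigr => j _; rewrite !mxE.
by rewrite rowK; case: i => [[|[|[|[|[|]]]]]] //= h; rewrite ?ve.
Qed.

Lemma frame_eq w f n e E u v : conformal_frame w f n e E ->
  lip u f = lip v f -> lip u w = lip v w -> lip u n = lip v n ->
  (forall i, lip u (e i) = lip v (e i)) -> u = v.
Proof.
move=> fr uf uw un ue; apply/eqP; rewrite -subr_eq0; apply/eqP.
by apply: (frame_inj fr) => [|||i]; rewrite lipDl lipNl ?uf ?uw ?un ?ue subrr.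
Qed.

Lemma frame_decomp w f n e E v : conformal_frame w f n e E ->
  v = - lip v f *: w - (lip v w + lip w w * lip v f) *: f + lip v n *: n
      + E^-1 *: (lip v (e 0) *: e 0 + lip v (e 1) *: e 1).
Proof.
move=> fr; have [ff fw E0 [[nn nf nw] [ne fe ew ee]]] := fr.
have wf : lip w f = -1 by rewrite lipC.
have fn : lip f n = 0 by rewrite lipC.
have wn : lip w n = 0 by rewrite lipC.
have ef i : lip (e i) f = 0 by rewrite lipC.
have en i : lip (e i) n = 0 by rewrite lipC.
have we i : lip w (e i) = 0 by rewrite lipC.
apply: (frame_eq fr) => [|||i].
- by rewrite !lipE ff wf nf !ef; ring.
- by rewrite !lipE fw nw !ew; ring.
- by rewrite !lipE fn wn nn !en; ring.
- rewrite !lipE fe we ne !ee.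
  have [->|->] := ord2P i.
  + by rewrite /=; field.
  + by rewrite /=; field.
Qed.

(** The inner product of the decomposition [frame_decomp] with [v] itself. *)
Lemma frame_norm w f n e E v : conformal_frame w f n e E ->
  lip v v = - 2 * lip v f * lip v w - lip w w * lip v f ^+ 2 + lip v n ^+ 2
    + E^-1 * (lip v (e 0) ^+ 2 + lip v (e 1) ^+ 2).
Proof.
move=> fr; rewrite {1}[in LHS](frame_decomp v fr) !lipE.
rewrite !(lipC w v) !(lipC f v) !(lipC n v) !(lipC (e _) v); ring.
Qed.

End LorentzAlgebra.

(** * Structure equations of the surface *)

Section IsothermicSurface.
Variables (R : realType) (U : set 'rV[R]_2) (w : 'rV[R]_5).
Variables (F N : 'rV[R]_2 -> 'rV[R]_5) (E : 'rV[R]_2 -> R).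
Variable k : 'I_2 -> 'rV[R]_2 -> R.
Hypothesis oU : open U.
Hypotheses (sF : smooth_on U F) (sE : smooth_on U E).
Hypothesis sk : forall i, smooth_on U (k i).
Hypothesis E0 : forall x, U x -> E x != 0.

Notation dF i := (pd i F).

Hypothesis FF : forall x, U x -> lip (F x) (F x) = 0.
Hypothesis Fw : forall x, U x -> lip (F x) w = -1.
Hypothesis sN : smooth_on U N.
Hypothesis NN : forall x, U x -> lip (N x) (N x) = 1.
Hypothesis NF : forall x, U x -> lip (N x) (F x) = 0.
Hypothesis Nw : forall x, U x -> lip (N x) w = 0.
Hypothesis NdF : forall i x, U x -> lip (N x) (dF i x) = 0.
Hypothesis dFdF : forall i j x, U x ->
  lip (dF i x) (dF j x) = if i == j then E x else 0.
Hypothesis ddFN : forall i j x, U x ->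
  lip (pd i (dF j) x) (N x) = if i == j then E x * k i x else 0.

Let sdF i : smooth_on U (dF i). Proof. exact: smooth_pd. Qed.

(** The sign with which the coordinate direction [i] enters [eta]. *)
Definition sgn (i : 'I_2) : R := if i == 0 then -1 else 1.

Definition meanH (x : 'rV[R]_2) : R := (k 0 x + k 1 x) / 2.
Definition skewL (x : 'rV[R]_2) : R := E x * (k 0 x - k 1 x).
Definition prodM (x : 'rV[R]_2) : R := - meanH x * skewL x.

Lemma sgnM i : sgn i * sgn i = 1.
Proof. by rewrite /sgn; case: ifP => _; ring. Qed.

Lemma smooth_meanH : smooth_on U meanH.
Proof. exact: smoothM (smoothD oU (sk 0) (sk 1)) (smooth_cst oU _). Qed.

Lemma smooth_skewL : smooth_on U skewL.
Proof. exact: smoothM sE (smoothD oU (sk 0) (smoothN oU (sk 1))). Qed.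

Lemma smooth_prodM : smooth_on U prodM.
Proof. exact: smoothM (smoothN oU smooth_meanH) smooth_skewL. Qed.

(** The inner products of first and second derivatives of [F] with the frame
    follow by differentiating the constant ones; together with [frame_eq] they
    give the structure equations. *)
Lemma lip_F_dF i x : U x -> lip (F x) (dF i x) = 0.
Proof.
move=> Ux; have := pd_lip_eq oU i sF sF FF Ux.
by rewrite pd_cst (lipC (dF i x)); lra.
Qed.

Lemma lip_dF_w i x : U x -> lip (dF i x) w = 0.
Proof.
move=> Ux; have := pd_lip_eq oU i sF (smooth_cst oU w) Fw Ux.
by rewrite !pd_cst lip0r subr0.
Qed.

Lemma frameP x : U x -> conformal_frame w (F x) (N x) (fun i => dF i x) (E x).
Proof.
move=> Ux; split; [exact: FF|exact: Fw|exact: E0|].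
split; first by split; [exact: NN|exact: NF|exact: Nw].
by split=> [i|i|i|i j]; [exact: NdF|exact: lip_F_dF|exact: lip_dF_w|exact: dFdF].
Qed.

(** Weingarten's equation. *)
Lemma pd_normal i x : U x -> pd i N x = - k i x *: dF i x.
Proof.
move=> Ux; apply: (frame_eq (frameP Ux)) => [|||j].
- rewrite (pd_lip_eq oU i sN sF NF Ux) pd_cst NdF//.
  by rewrite lipZl (lipC _ (F x)) lip_F_dF//; ring.
- rewrite (pd_lip_eq oU i sN (smooth_cst oU w) Nw Ux) !pd_cst.
  by rewrite lip0r lipZl lip_dF_w//; ring.
- have := pd_lip_eq oU i sN sN NN Ux; rewrite pd_cst.
  by rewrite lipZl (lipC (dF i x)) NdF// (lipC (N x) (pd i N x)); lra.
- rewrite (pd_lip_eq oU i sN (sdF j) (NdF j) Ux) pd_cst lipZl dFdF//.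
  by rewrite lipC ddFN//; case: eqP => _; ring.
Qed.

Lemma lip_ddF_dF i j x : U x ->
  lip (pd i (dF j) x) (dF j x) = pd i E x / 2.
Proof.
move=> Ux; have ee y : U y -> lip (dF j y) (dF j y) = E y.
  by move=> Uy; rewrite dFdF// eqxx.
by have := pd_lip_eq oU i (sdF j) (sdF j) ee Ux; rewrite (lipC (dF j x)); lra.
Qed.

(** The derivatives of [F] commute, so the other component of a mixed
    derivative reduces to [lip_ddF_dF]. *)
Lemma lip_ddF_dF_swap i j x : U x ->
  lip (pd i (dF j) x) (dF i x) = pd j E x / 2.
Proof. by move=> Ux; rewrite (vec_pdC oU i j sF Ux) lip_ddF_dF. Qed.

Lemma lip_ddF_F i j x : U x ->
  lip (pd i (dF j) x) (F x) = if i == j then - E x else 0.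
Proof.
move=> Ux; have ef y : U y -> lip (dF j y) (F y) = 0.
  by move=> Uy; rewrite lipC lip_F_dF.
rewrite (pd_lip_eq oU i (sdF j) sF ef Ux) pd_cst.
by rewrite dFdF// eq_sym; case: ifP => _; ring.
Qed.

(** The Codazzi equations: compare the two mixed derivatives of the unit
    normal. *)
Lemma codazzi i j x : U x -> i != j ->
  E x * pd i (k j) x = (k i x - k j x) * pd i E x / 2.
Proof.
move=> Ux ij.
have dd a b : lip (pd a (pd b N) x) (dF j x) =
    - pd a (k b) x * lip (dF b x) (dF j x)
    - k b x * lip (pd a (dF b) x) (dF j x).
  rewrite (pd_congr oU a (fun y Uy => pd_normal b Uy) Ux).
  rewrite (pd_scale oU a (smoothN oU (sk b)) (sdF b) Ux).
  by rewrite (pdN a (sk b) Ux) lipDl !lipZl !mulNr.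
have := congr1 (fun u => lip u (dF j x)) (vec_pdC oU i j sN Ux).
rewrite /= !dd !dFdF// eqxx (negPf ij) lip_ddF_dF// lip_ddF_dF_swap//; lra.
Qed.

Lemma pd_meanH i x : U x ->
  pd i meanH x = (pd i (k 0) x + pd i (k 1) x) / 2.
Proof.
move=> Ux; rewrite /meanH.
rewrite (pdM i (smoothD oU (sk 0) (sk 1)) (smooth_cst oU _) Ux).
by rewrite pd_cst (pdD i (sk 0) (sk 1) Ux); ring.
Qed.

(** In terms of [H] and [L], the Codazzi equations express the derivatives of
    [L] by those of [H]. *)
Lemma pd_skewL i x : U x ->
  pd i skewL x = - 2 * sgn i * E x * pd i meanH x.
Proof.
move=> Ux; rewrite pd_meanH// /skewL.
rewrite (pdM i sE (smoothD oU (sk 0) (smoothN oU (sk 1))) Ux).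
rewrite (pdD i (sk 0) (smoothN oU (sk 1)) Ux) (pdN i (sk 1) Ux).
have [->|->] := ord2P i.
- by have := @codazzi 0 1 x Ux isT; rewrite /sgn /=; lra.
- by have := @codazzi 1 0 x Ux isT; rewrite /sgn /=; lra.
Qed.

Lemma pd_prodM i x : U x ->
  pd i prodM x = 2 * sgn i * k i x * E x * pd i meanH x.
Proof.
move=> Ux; rewrite /prodM.
rewrite (pdM i (smoothN oU smooth_meanH) smooth_skewL Ux).
rewrite (pdN i smooth_meanH Ux) pd_skewL//.
have [->|->] := ord2P i; by rewrite /sgn /= /meanH /skewL; field.
Qed.

(** * From conserved quantities to the differential equation *)

Definition special_equation (A B C D : R) (x : 'rV[R]_2) : Prop :=
  E x * (pd 0 meanH x ^+ 2 + pd 1 meanH x ^+ 2) + 1 / 4 * prodM x ^+ 2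
  + A * prodM x - 2 * B * meanH x + C * skewL x + D
  + 1 / 4 * skewL x ^+ 2 * - lip w w = 0.

Lemma frame_lip x u v : U x ->
  lip u (F x) = lip v (F x) -> lip u w = lip v w -> lip u (N x) = lip v (N x) ->
  (forall i, lip u (dF i x) = lip v (dF i x)) -> u = v.
Proof. by move=> Ux; apply: (frame_eq (frameP Ux)). Qed.

(** The vector [(F, v) F_i - (F_i, v) F]: the 1-form [eta] maps [v] to
    [s_i / E] times this vector in direction [i]. *)
Definition etav i x v := lip (F x) v *: dF i x - lip (dF i x) v *: F x.

Section Forward.
Variables (c : R) (p1 p2 : 'rV[R]_2 -> 'rV[R]_5) (x0 : 'rV[R]_2).
Hypothesis cU : connected U.
Hypotheses (sp1 : smooth_on U p1) (sp2 : smooth_on U p2).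
Hypothesis (Ux0 : U x0).
Hypothesis p2_neq0 : p2 x0 != 0.
Hypothesis dp1 : forall i x, U x -> pd i p1 x = (c * sgn i / E x) *: dF i x.
Hypothesis dp2 : forall i x, U x -> pd i p2 x = - (sgn i / E x) *: etav i x (p1 x).
Hypothesis p2F : forall x, U x -> lip (p2 x) (F x) = 0.
Hypothesis p2dF : forall i x, U x -> lip (p2 x) (dF i x) = 0.

Let a := lip (p2 x0) (N x0).

(** The image of [eta] is spanned by [F] and its derivatives, to which [N] is
    orthogonal; hence the normal part of [p2] is constant. *)
Lemma top_normal_part x : U x -> lip (p2 x) (N x) = a.
Proof.
move=> Ux; apply: (pd0_constant oU cU (smooth_lip oU sp2 sN)) => // i y Uy.
rewrite (pd_lip oU i sp2 sN Uy) dp2// pd_normal// /etav !lipE p2dF//.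
by rewrite (lipC (F y) (N y)) NF// (lipC (dF i y) (N y)) NdF//; ring.
Qed.

Lemma lip_dp2 i x v : U x -> lip (pd i p2 x) v =
  - (sgn i / E x) * (lip (p1 x) (F x) * lip (dF i x) v
                     - lip (p1 x) (dF i x) * lip (F x) v).
Proof. by move=> Ux; rewrite dp2// /etav !lipE !(lipC _ (p1 x)). Qed.

Lemma top_decomp x : U x -> p2 x = a *: N x - lip (p2 x) w *: F x.
Proof.
move=> Ux; apply: (frame_lip Ux) => [|||i]; rewrite !lipE.
- by rewrite p2F// NF// FF//; ring.
- by rewrite Nw// Fw//; ring.
- by rewrite top_normal_part// NN// (lipC (F x) (N x)) NF//; ring.
- by rewrite p2dF// NdF// lip_F_dF//; ring.
Qed.

(** The tangential component of [d p2 = - p1 eta] in direction [i], found by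
    differentiating [(p2, F_i) = 0]. *)
Lemma top_tangential i x : U x ->
  a * E x * k i x + lip (p2 x) w * E x = sgn i * lip (p1 x) (F x).
Proof.
move=> Ux; have := pd_lip_eq oU i sp2 (sdF i) (p2dF i) Ux.
have -> : lip (p2 x) (pd i (dF i) x) = a * E x * k i x + lip (p2 x) w * E x.
  rewrite {1}(top_decomp Ux) !lipE (lipC (N x)) ddFN// eqxx.
  by rewrite (lipC (F x)) lip_ddF_F// eqxx; ring.
rewrite pd_cst lip_dp2// dFdF// eqxx lip_F_dF// mulr0 subr0.
have := E0 Ux; move: (lip _ w) (lip _ (F x)) => b l E0x.
have -> : - (sgn i / E x) * (l * E x) = - sgn i * l by field.
lra.
Qed.

(** The sum of the two equations [top_tangential]: in [p2 = a N + b F] one has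
    [b = - (p2, w)], so this says [b = a H]. *)
Lemma top_w x : U x -> lip (p2 x) w = - a * meanH x.
Proof.
move=> Ux; apply: (mulIf (E0 Ux)); rewrite /meanH.
by have := top_tangential 0 Ux; have := top_tangential 1 Ux; rewrite /sgn /=; lra.
Qed.

(** The difference of the two equations [top_tangential]. *)
Lemma middle_F x : U x -> lip (p1 x) (F x) = - a / 2 * skewL x.
Proof.
move=> Ux; rewrite /skewL.
by have := top_tangential 0 Ux; have := top_tangential 1 Ux; rewrite /sgn /=; lra.
Qed.

(** The component of [d p2 = - p1 eta] along [F]. *)
Lemma middle_dF i x : U x -> lip (p1 x) (dF i x) = sgn i * E x * a * pd i meanH x.
Proof.
move=> Ux; have := pd_lip_eq oU i sp2 (smooth_cst oU w) top_w Ux.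
rewrite pd_cst lip0r subr0 lip_dp2// lip_dF_w// Fw// (pdZ oU i _ smooth_meanH Ux).
move: (lip (p1 x) (dF i x)) => l h; have E0x := E0 Ux.
have -> : l = sgn i * E x * (sgn i / E x * l).
  by rewrite -{1}(mul1r l) -(sgnM i); field.
have -> : sgn i / E x * l = a * pd i meanH x by lra.
by ring.
Qed.

Lemma top_normal_neq0 : a != 0.
Proof.
apply: contra_neq p2_neq0 => a0; rewrite (top_decomp Ux0) top_w// a0.
by rewrite oppr0 mul0r !scale0r subrr.
Qed.

Lemma lip_dp1 i x v : U x ->
  lip (pd i p1 x) v = c * sgn i / E x * lip (dF i x) v.
Proof. by move=> Ux; rewrite dp1// lipZl. Qed.

Lemma middle_w x : U x -> lip (p1 x) w = lip (p1 x0) w.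
Proof.
move=> Ux; have sw := smooth_cst oU w.
apply: (pd0_constant oU cU (smooth_lip oU sp1 sw)) => // i y Uy.
by rewrite (pd_lip oU i sp1 sw Uy) pd_cst lip0r lip_dp1// lip_dF_w//; ring.
Qed.

(** Both derivatives are multiples of [s_i k_i E H_i]: by Weingarten's equation
    for [(p1, N)], by the Codazzi equations for [M]. *)
Lemma middle_N x : U x -> lip (p1 x) (N x) + a / 2 * prodM x =
  lip (p1 x0) (N x0) + a / 2 * prodM x0.
Proof.
have sM := smoothM oU (smooth_cst oU (a / 2)) smooth_prodM.
have s1 := smooth_lip oU sp1 sN.
move=> Ux; apply: (pd0_constant oU cU (smoothD oU s1 sM)) => // i y Uy.
rewrite (pdD i s1 sM Uy) (pd_lip oU i sp1 sN Uy) (pdZ oU i _ smooth_prodM Uy).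
rewrite pd_prodM// lip_dp1// pd_normal// lipZr middle_dF// (lipC _ (N y)) NdF//.
by have E0y := E0 Uy; field.
Qed.

(** As [p1_i] is [c s_i / E] times [F_i], the derivative of [(p1, p1)] is
    [2 c s_i / E] times [(p1, F_i)], which is [middle_dF]. *)
Lemma middle_norm x : U x -> lip (p1 x) (p1 x) - 2 * c * a * meanH x =
  lip (p1 x0) (p1 x0) - 2 * c * a * meanH x0.
Proof.
have sH := smoothM oU (smooth_cst oU (2 * c * a)) smooth_meanH.
have s1 := smooth_lip oU sp1 sp1.
move=> Ux; apply: (pd0_constant oU cU (smoothD oU s1 (smoothN oU sH))) => // i y Uy.
rewrite (pdD i s1 (smoothN oU sH) Uy) (pdN i sH Uy) (pd_lip oU i sp1 sp1 Uy).
rewrite (pdZ oU i _ smooth_meanH Uy) (lipC (p1 y)) lip_dp1// lipC middle_dF//.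
have E0y := E0 Uy; have s2 := sgnM i.
have -> : c * sgn i / E y * (sgn i * E y * a * pd i meanH y) =
  (sgn i * sgn i) * (c * a * pd i meanH y) by field.
by rewrite s2; ring.
Qed.

(** Both sides of [frame_norm] for [p1] are now known functions of [H], [L] and
    [M]; the equation appears after division by [a^2]. *)
Lemma special_of_conserved :
  exists A B C D, forall x, U x -> special_equation A B C D x.
Proof.
have a0 := top_normal_neq0.
pose m := lip (p1 x0) (N x0) + a / 2 * prodM x0.
pose q := lip (p1 x0) (p1 x0) - 2 * c * a * meanH x0.
pose g := lip (p1 x0) w.
(* m, q, g: the constant values of (p1, N) + a M / 2, (p1, p1) - 2 c a H, (p1, w) *)
exists (- m / a), (c / a), (g / a), ((m ^+ 2 - q) / a ^+ 2) => x Ux.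
have := frame_norm (p1 x) (frameP Ux).
rewrite !middle_dF// middle_F// middle_w// -/g.
have -> : lip (p1 x) (p1 x) = q + 2 * c * a * meanH x.
  by rewrite /q -(middle_norm Ux); ring.
have -> : lip (p1 x) (N x) = m - a / 2 * prodM x by rewrite /m -(middle_N Ux); ring.
rewrite /sgn /= /special_equation.
move: (pd 0 _ x) (pd 1 _ x) (meanH x) (skewL x) (prodM x) (lip w w) (E x) (E0 Ux)
  => H0 H1 H L M W e e0 h.
apply: (@mulfI _ (a ^+ 2)); first by rewrite expf_neq0.
rewrite mulr0.
have {}h : - 2 * (- a / 2 * L) * g - W * (- a / 2 * L) ^+ 2 + (m - a / 2 * M) ^+ 2
   + a ^+ 2 * e * (H0 ^+ 2 + H1 ^+ 2) - (q + 2 * c * a * H) = 0.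
  by rewrite h; field.
by rewrite -[RHS]h; field.
Qed.

End Forward.

(** * From the differential equation to conserved quantities *)

Lemma lip_ddF_w i j x : U x -> lip (pd i (dF j) x) w = 0.
Proof.
move=> Ux.
have := pd_lip_eq oU i (sdF j) (smooth_cst oU w) (fun y Uy => lip_dF_w j Uy) Ux.
by rewrite !pd_cst lip0r subr0.
Qed.

(** The mixed derivative has no component along [F], [w] or [N], as the
    coordinates are conformal curvature line coordinates. *)
Lemma ddF_mixed i j x : U x -> i != j -> pd i (dF j) x =
  (2 * E x)^-1 *: (pd j E x *: dF i x + pd i E x *: dF j x).
Proof.
move=> Ux ij; have E0x := E0 Ux; have ji : j != i by rewrite eq_sym.
apply: (frame_lip Ux) => [|||l]; rewrite !lipE.
- by rewrite lip_ddF_F// (negPf ij) !(lipC _ (F x)) !lip_F_dF//; ring.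
- by rewrite lip_ddF_w// !lip_dF_w//; ring.
- by rewrite ddFN// (negPf ij) !(lipC _ (N x)) !NdF//; ring.
- have [->|->] : l = i \/ l = j.
    by move: ij; case: (ord2P i) (ord2P j) (ord2P l) => -> [->|->] [->|->] //;
      [left|right|right|left].
  + by rewrite lip_ddF_dF_swap// !dFdF// eqxx (negPf ji); field.
  + by rewrite lip_ddF_dF// !dFdF// eqxx (negPf ij); field.
Qed.

(** The two mixed derivatives of [L], computed from [pd_skewL], agree. *)
Lemma meanH_mixed i j x : U x -> i != j ->
  2 * E x * pd i (pd j meanH) x + pd i E x * pd j meanH x
    + pd j E x * pd i meanH x = 0.
Proof.
move=> Ux ij; have sdH := smooth_pd _ smooth_meanH.
have dd a b : pd a (pd b skewL) x = - 2 * sgn b *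
    (pd a E x * pd b meanH x + E x * pd a (pd b meanH) x).
  have sEH := smoothM oU sE (sdH b).
  have LE y : U y -> pd b skewL y = - 2 * sgn b * (E y * pd b meanH y).
    by move=> Uy; rewrite pd_skewL//; ring.
  by rewrite (pd_congr oU a LE Ux) (pdZ oU a _ sEH Ux) (pdM a sE (sdH b) Ux).
have := pdC oU i j smooth_skewL Ux; rewrite !dd (pdC oU j i smooth_meanH Ux).
by move: ij; case: (ord2P i) (ord2P j) => -> [->|->] // _; rewrite /sgn /=; lra.
Qed.

Section Backward.
Variables A B C D : R.
Hypothesis special : forall x, U x -> special_equation A B C D x.
Hypothesis dH_neq0 : forall i x, U x -> pd i meanH x != 0.

(** The vector whose inner products with [F], [w], [N] and [F_i] are
    [- L / 2], [C], [- M / 2 - A] and [s_i E H_i]: the values forced on [p1]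
    when the constant [a] of [p2] is [1]. *)
Definition middle_coef x : 'rV[R]_5 :=
  (skewL x * 2^-1) *: w + (skewL x * (lip w w / 2) + - C) *: F x
  + (- pd 0 meanH x) *: dF 0 x + pd 1 meanH x *: dF 1 x
  + (prodM x * (- 2^-1) + - A) *: N x.

Definition top_coef x : 'rV[R]_5 := N x + meanH x *: F x.

Let sdH i : smooth_on U (pd i meanH). Proof. exact/smooth_pd/smooth_meanH. Qed.

Lemma smooth_top : smooth_on U top_coef.
Proof. exact: (smoothD oU sN (smoothZ oU smooth_meanH sF)). Qed.

Lemma smooth_middle : smooth_on U middle_coef.
Proof.
have sc (a : R) := smooth_cst oU a; have sw := smooth_cst oU w.
have s1 := smoothZ oU (smoothM oU smooth_skewL (sc 2^-1)) sw.
have s2 := smoothZ oU (smoothD oU (smoothM oU smooth_skewL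
  (sc (lip w w / 2))) (sc (- C))) sF.
have s3 := smoothZ oU (smoothN oU (sdH 0)) (sdF 0).
have s4 := smoothZ oU (sdH 1) (sdF 1).
have s5 := smoothZ oU (smoothD oU (smoothM oU smooth_prodM
  (sc (- 2^-1))) (sc (- A))) sN.
exact: (smoothD oU (smoothD oU (smoothD oU (smoothD oU s1 s2) s3) s4) s5).
Qed.

Lemma lip_middle x v : lip (middle_coef x) v = skewL x / 2 * lip w v
  + (skewL x * (lip w w / 2) - C) * lip (F x) v - pd 0 meanH x * lip (dF 0 x) v
  + pd 1 meanH x * lip (dF 1 x) v - (prodM x / 2 + A) * lip (N x) v.
Proof. by rewrite /middle_coef !lipE; ring. Qed.

Lemma lip_middle_F x : U x -> lip (middle_coef x) (F x) = - 2^-1 * skewL x.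
Proof.
move=> Ux; rewrite lip_middle (lipC w) Fw// FF// NF// !(lipC (dF _ x)) !lip_F_dF//.
ring.
Qed.

Lemma lip_middle_w x : U x -> lip (middle_coef x) w = C.
Proof. by move=> Ux; rewrite lip_middle Fw// Nw// !lip_dF_w//; field. Qed.

Lemma lip_middle_N x : U x -> lip (middle_coef x) (N x) = - 2^-1 * prodM x + - A.
Proof.
move=> Ux; rewrite lip_middle (lipC w) Nw// (lipC (F x)) NF// NN//.
by rewrite !(lipC (dF _ x)) !NdF//; field.
Qed.

Lemma lip_middle_dF i x : U x ->
  lip (middle_coef x) (dF i x) = sgn i * (E x * pd i meanH x).
Proof.
move=> Ux; rewrite lip_middle (lipC w) lip_dF_w// lip_F_dF// NdF// !dFdF//.
by have [->|->] := ord2P i; rewrite /sgn /=; ring.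
Qed.

(** This is the differential equation, rewritten by [frame_norm]. *)
Lemma middle_sqr x : U x ->
  lip (middle_coef x) (middle_coef x) = 2 * B * meanH x + (A ^+ 2 - D).
Proof.
move=> Ux; rewrite (frame_norm _ (frameP Ux)) lip_middle_F// lip_middle_w//.
rewrite lip_middle_N// !lip_middle_dF//.
have := special Ux; rewrite /special_equation /sgn /=.
move: (pd 0 _ x) (pd 1 _ x) (meanH x) (skewL x) (prodM x) (lip w w) (E x) (E0 Ux)
  => H0 H1 H L M W e e0 h.
apply/eqP; rewrite -subr_eq0 -[X in _ == X]h; apply/eqP; by field.
Qed.

(** By [ddF_mixed] this component is a multiple of the left-hand side of
    [meanH_mixed]. *)
Lemma lip_pd_middle_dF_mixed i j x : U x -> i != j ->
  lip (pd i middle_coef x) (dF j x) = 0.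
Proof.
move=> Ux ij; have E0x := E0 Ux; have sEH := smoothM oU sE (sdH j).
rewrite (pd_lip_eq oU i smooth_middle (sdF j) (lip_middle_dF j) Ux).
rewrite (pdZ oU i _ sEH Ux) (pdM i sE (sdH j) Ux) ddF_mixed// !lipZr lipDr !lipZr.
rewrite !lip_middle_dF//; have := meanH_mixed Ux ij.
have -> : pd i E x * pd j meanH x + E x * pd i (pd j meanH) x = 
  2^-1 * (2 * E x * pd i (pd j meanH) x + pd i E x * pd j meanH x
    + pd j E x * pd i meanH x) + 
  2^-1 * (pd i E x * pd j meanH x - pd j E x * pd i meanH x) by field.
move=> ->; move: ij; case: (ord2P i) (ord2P j) => -> [->|->] // _;
by rewrite /sgn /=; field.
Qed.

(** The components of [p1_i] along [F], [w], [N] and the other tangent vector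
    vanish identically, so the derivative of [(p1, p1)] is twice the remaining
    component times the coefficient [s_i H_i] of [F_i] in [p1]; by
    [middle_sqr] it is also [2 B H_i], and [H_i] can be cancelled. *)
Lemma pd_middle i x : U x -> pd i middle_coef x = (B * sgn i / E x) *: dF i x.
Proof.
move=> Ux; have E0x := E0 Ux; have sm := smooth_middle.
have s0 (a : R) := smooth_cst oU a.
have dF0 : lip (pd i middle_coef x) (F x) = 0.
  rewrite (pd_lip_eq oU i sm sF lip_middle_F Ux) (pdZ oU i _ smooth_skewL Ux).
  by rewrite pd_skewL// lip_middle_dF//; field.
have dw : lip (pd i middle_coef x) w = 0.
  by rewrite (pd_lip_eq oU i sm (smooth_cst oU w) lip_middle_w Ux) !pd_cst lip0r subrr.
have dN : lip (pd i middle_coef x) (N x) = 0.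
  have sM := smoothM oU (s0 (- 2^-1)) smooth_prodM.
  rewrite (pd_lip_eq oU i sm sN lip_middle_N Ux) (pdD i sM (s0 (- A)) Ux).
  rewrite (pdZ oU i _ smooth_prodM Ux) pd_cst pd_prodM// pd_normal// lipZr.
  by rewrite lip_middle_dF//; field.
have dd : lip (pd i middle_coef x) (dF i x) = B * sgn i.
  have sH := smoothM oU (s0 (2 * B)) smooth_meanH.
  have := pd_lip_eq oU i sm sm middle_sqr Ux.
  rewrite (pdD i sH (s0 _) Ux) (pdZ oU i _ smooth_meanH Ux) pd_cst addr0.
  rewrite (lipC (middle_coef x)) => h.
  have {}h : lip (middle_coef x) (pd i middle_coef x) = B * pd i meanH x.
    by rewrite lipC; lra.
  apply: (mulIf (dH_neq0 i Ux)); rewrite -mulrA (mulrC (sgn i)) mulrA -h.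
  rewrite lip_middle (lipC w) dw !(lipC _ (pd i middle_coef x)) dF0 dN.
  have [->|->] := ord2P i; rewrite /sgn /=.
  + by rewrite (@lip_pd_middle_dF_mixed 0 1 x Ux isT); ring.
  + by rewrite (@lip_pd_middle_dF_mixed 1 0 x Ux isT); ring.
apply: (frame_lip Ux) => [|||j]; rewrite lipZl.
- by rewrite dF0 lipC lip_F_dF// mulr0.
- by rewrite dw lip_dF_w// mulr0.
- by rewrite dN lipC NdF// mulr0.
- have [->|ji] := eqVneq j i; first by rewrite dFdF// eqxx dd; field.
  have ij : i != j by rewrite eq_sym.
  by rewrite dFdF// (negPf ij) lip_pd_middle_dF_mixed// mulr0.
Qed.

Lemma pd_top i x : U x -> pd i top_coef x = - (sgn i / E x) *: etav i x (middle_coef x).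
Proof.
move=> Ux; have E0x := E0 Ux.
rewrite /top_coef (pdD i sN (smoothZ oU smooth_meanH sF) Ux).
rewrite (pd_scale oU i smooth_meanH sF Ux) pd_normal// /etav.
rewrite (lipC (F x)) (lipC (dF i x)) lip_middle_F// lip_middle_dF//.
have -> : - (sgn i / E x) *: (- 2^-1 * skewL x *: dF i x
    - sgn i * (E x * pd i meanH x) *: F x) =
    (- k i x + meanH x) *: dF i x + pd i meanH x *: F x.
  rewrite scalerBr !scalerA -scaleNr; congr (_ *: _ + _ *: _).
    rewrite /skewL /meanH.
    by have [->|->] := ord2P i; rewrite /sgn /=; field.
  rewrite -[RHS]mul1r -(sgnM i); by field.
by rewrite scalerDl -addrA (addrC (pd i meanH x *: F x)).
Qed.

Lemma lip_top_N x : U x -> lip (top_coef x) (N x) = 1.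
Proof. by move=> Ux; rewrite /top_coef !lipE NN// (lipC (F x)) NF//; ring. Qed.

Lemma etav_top i x : U x -> etav i x (top_coef x) = 0.
Proof.
move=> Ux; rewrite /etav /top_coef !lipE FF// (lipC (F x) (N x)) NF//.
rewrite (lipC (dF i x) (N x)) NdF// (lipC (dF i x)) lip_F_dF//.
by rewrite !mulr0 !addr0 !scale0r subr0.
Qed.

End Backward.

(** * Polynomial conserved quantities of degree two *)

Section ConservedQuantities.
Variable eta : 'I_2 -> 'rV[R]_2 -> 'M[R]_5.
Hypothesis etaE : forall i x v, U x ->
  v *m eta i x = (sgn i / E x) *: etav i x v.

Lemma cubic_eq0 n (a0 a1 a2 a3 : 'rV[R]_n) :
  (forall t, a0 + t *: a1 + t ^+ 2 *: a2 + t ^+ 3 *: a3 = 0) ->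
  [/\ a0 = 0, a1 = 0, a2 = 0 & a3 = 0].
Proof.
move=> a_eq0; suff h j : [/\ a0 0 j = 0, a1 0 j = 0, a2 0 j = 0 & a3 0 j = 0].
  by split; apply/rowP => j; have [? ? ? ?] := h j; rewrite [RHS]mxE.
have e t : a0 0 j + t * a1 0 j + t ^+ 2 * a2 0 j + t ^+ 3 * a3 0 j = 0.
  by have /rowP/(_ j) := a_eq0 t; rewrite !mxE.
(* four values of t determine a cubic *)
have := e 0; have := e 1; have := e (- 1); have := e 2.
by split; lra.
Qed.

(** The condition on [p] is a cubic polynomial in [t] whose coefficients must
    vanish. *)
Lemma conserved2P (p : nat -> 'rV[R]_2 -> 'rV[R]_5) i x :
  (forall j, (j <= 2)%N -> smooth_on U (p j)) -> U x ->
  (forall t, partial i (poly_section 2 p t) x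
             + t *: (poly_section 2 p t x *m eta i x) = 0) <->
  [/\ pd i (p 0%N) x = 0, pd i (p 1%N) x + p 0%N x *m eta i x = 0,
      pd i (p 2%N) x + p 1%N x *m eta i x = 0 & p 2%N x *m eta i x = 0].
Proof.
move=> sp Ux; rewrite -pdE.
have expand t : pd i (poly_section 2 p t) x
    + t *: (poly_section 2 p t x *m eta i x) =
    pd i (p 0%N) x + t *: (pd i (p 1%N) x + p 0%N x *m eta i x)
    + t ^+ 2 *: (pd i (p 2%N) x + p 1%N x *m eta i x)
    + t ^+ 3 *: (p 2%N x *m eta i x).
  rewrite (pd_poly_section oU i t sp Ux) /poly_section !big_ord_recl !big_ord0 /=.
  rewrite !mulmxDl -!scalemxAl mul0mx.
  by apply/rowP => j; rewrite !mxE; ring.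
split=> [h|[h0 h1 h2 h3] t].
  by apply: cubic_eq0 => t; rewrite -expand.
by rewrite expand h0 h1 h2 h3 !scaler0 !addr0.
Qed.

Lemma special_of_special_isothermic : connected U ->
  special_isothermic U eta 2 w ->
  exists A B C D, forall x, U x -> special_equation A B C D x.
Proof.
move=> cU [p [[sp [x0 [Ux0 p2x0]] peq] p0w]].
have {}peq i x (Ux : U x) := (conserved2P i sp Ux).1 (fun t => peq t i x Ux).
have [c p0x0] : exists c, p 0%N x0 = c *: w by apply/vlineP/p0w.
have p0c x : U x -> p 0%N x = c *: w.
  move=> Ux; rewrite -p0x0.
  apply: (vec_pd0_constant oU cU (sp 0%N isT)) => // i y Uy.
  by have [] := peq i y Uy.
have dp1 i x : U x -> pd i (p 1%N) x = (c * sgn i / E x) *: dF i x.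
  move=> Ux; have [_ /eqP + _ _] := peq i x Ux; rewrite addr_eq0 => /eqP ->.
  rewrite etaE// p0c// /etav !lipZr Fw// lip_dF_w//.
  rewrite mulr0 scale0r subr0 mulrN1 !scaleNr scalerN opprK scalerA.
  by congr (_ *: _); ring.
have dp2 i x : U x -> pd i (p 2%N) x = - (sgn i / E x) *: etav i x (p 1%N x).
  move=> Ux; have [_ _ /eqP + _] := peq i x Ux; rewrite addr_eq0 => /eqP ->.
  by rewrite etaE// scaleNr.
have etav0 i x : U x -> etav i x (p 2%N x) = 0.
  move=> Ux; have [_ _ _ /eqP] := peq i x Ux; rewrite etaE// scaler_eq0.
  have /negPf-> : sgn i / E x != 0.
    rewrite mulf_neq0 ?invr_neq0 ?E0// /sgn.
    by case: ifP => _; rewrite ?oner_eq0// oppr_eq0 oner_eq0.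
  by move=> /eqP.
have p2F x : U x -> lip (p 2%N x) (F x) = 0.
  move=> Ux; have := congr1 (fun v => lip v (dF 0 x)) (etav0 0 x Ux).
  rewrite /= /etav lipDl lipNl !lipZl dFdF// eqxx lip_F_dF// mulr0 subr0 lip0l.
  by move=> /eqP; rewrite mulf_eq0 (negPf (E0 Ux)) orbF lipC => /eqP.
have p2dF i x : U x -> lip (p 2%N x) (dF i x) = 0.
  move=> Ux; have := congr1 (fun v => lip v w) (etav0 i x Ux).
  rewrite /= /etav lipDl lipNl !lipZl lip_dF_w// Fw// lip0l (lipC (p 2%N x)); lra.
exact: (special_of_conserved cU (sp 1%N isT) (sp 2%N isT) Ux0 p2x0 dp1 dp2 p2F p2dF).
Qed.

Lemma special_isothermic_of_special A B C D : U !=set0 ->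
  (forall x, U x -> special_equation A B C D x) ->
  (forall i x, U x -> pd i meanH x != 0) ->
  special_isothermic U eta 2 w.
Proof.
move=> [x0 Ux0] special dH_neq0.
pose p (j : nat) : 'rV[R]_2 -> 'rV[R]_5 :=
  match j with 0%N => fun=> B *: w | 1%N => middle_coef A C | _ => top_coef end.
have sp j : (j <= 2)%N -> smooth_on U (p j).
  case: j => [|[|[|]]]// _; [exact: smooth_cst|exact: smooth_middle|exact: smooth_top].
exists p; split; last by move=> x _; apply/vlineP; exists B.
split=> //.
  exists x0; split=> //; apply/eqP => /(congr1 (fun v => lip v (N x0))) /eqP.
  by rewrite /= lip_top_N// lip0l oner_eq0.
move=> t i x Ux; move: t; apply/(conserved2P i sp Ux); split.
- by rewrite /p pd_cst.
- rewrite /p etaE// (pd_middle special dH_neq0)//.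
  rewrite /etav !lipZr Fw// lip_dF_w// mulr0 scale0r subr0 mulrN1 !scaleNr.
  rewrite scalerN scalerA [X in _ - X *: _](_ : _ = B * sgn i / E x) ?subrr//; ring.
- by rewrite /p etaE// (pd_top A C i Ux) scaleNr addNr.
- by rewrite /p etaE// etav_top// scaler0.
Qed.

End ConservedQuantities.
End IsothermicSurface.

Theorem mainTheorem4 (R : realType) (U : set 'rV[R]_2)
    (Lambda : 'rV[R]_2 -> {vspace 'rV[R]_5})
    (eta : 'I_2 -> 'rV[R]_2 -> 'M[R]_5)
    (w : 'rV[R]_5) (F N : 'rV[R]_2 -> 'rV[R]_5)
    (theta k1 k2 : 'rV[R]_2 -> R) :
  open U -> connected U ->
  isothermic U Lambda eta ->
  w != 0 ->
  lift_on U Lambda F ->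
  (forall x, U x -> space_form w (F x)) ->
  unit_normal U w F N ->
  conformal_coordinates U F theta ->
  curvature_line_coordinates U F N theta k1 k2 ->
  coordinates_correspond U Lambda eta ->
  let H : 'rV[R]_2 -> R := fun x => (k1 x + k2 x) / 2 in
  let L : 'rV[R]_2 -> R := fun x => expR (2 * theta x) * (k1 x - k2 x) in
  let M : 'rV[R]_2 -> R := fun x => - H x * L x in
  let K : R := - lip w w in
  (forall x, U x -> partial 0 H x * partial 1 H x != 0) ->
  (special_isothermic U eta 2 w <->
   exists A B C D : R, forall x, U x ->
     expR (2 * theta x) * ((partial 0 H x) ^+ 2 + (partial 1 H x) ^+ 2)
     + 1 / 4 * M x ^+ 2 + A * M x - 2 * B * H x + C * L x + D
     + 1 / 4 * L x ^+ 2 * K = 0).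
Proof.
move=> oU cU iso _ lift FE [sN normal] conf curv corr H L M K dH_neq0.
have [_ [_ [_ [_ [x0 [Ux0 _]]] _ _]]] := iso.
have [sF _] := lift.
have sdF i : smooth_on U (pd i F) by apply: smooth_pd.
(* E and the principal curvatures, expressed by derivatives of F and N, so that
   their smoothness is that of F and N *)
pose E x := lip (pd 0 F x) (pd 0 F x).
pose k i x := lip (pd i (pd i F) x) (N x) / E x.
have Etheta x : U x -> expR (2 * theta x) = E x.
  by move=> Ux; have := conf x Ux 0 0; rewrite /E pdE /first_form eqxx => ->.
have E0 x : U x -> E x != 0 by move=> /Etheta <-; rewrite gt_eqF// expR_gt0.
have sE : smooth_on U E by apply: smooth_lip.
have sk i : smooth_on U (k i).
  by apply: smoothM (smoothV oU E0 sE) => //; apply/smooth_lip/sN/smooth_pd.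
have FF x : U x -> lip (F x) (F x) = 0 by move=> /FE[[]].
have Fw x : U x -> lip (F x) w = -1 by move=> /FE[].
have NN x : U x -> lip (N x) (N x) = 1 by move=> /normal[].
have NF x : U x -> lip (N x) (F x) = 0 by move=> /normal[].
have Nw x : U x -> lip (N x) w = 0 by move=> /normal[].
have NdF i x : U x -> lip (N x) (pd i F x) = 0.
  by move=> /normal[_ _ _]; rewrite pdE; apply.
have dFdF i j x : U x -> lip (pd i F x) (pd j F x) = if i == j then E x else 0.
  by move=> Ux; have := conf x Ux i j; rewrite /first_form Etheta// pdE.
have ddFN i j x : U x ->
    lip (pd i (pd j F) x) (N x) = if i == j then E x * k i x else 0.
  move=> Ux; have [_ _] := curv x Ux; rewrite /second_form -!pdE => c01 c10.
  have [<-|ij] := eqVneq i j; first by rewrite /k mulrCA divff ?E0// mulr1.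
  move: ij; case: (ord2P i) (ord2P j) => -> [->|->] // _.
have k1E x : U x -> k1 x = k 0 x.
  move=> Ux; have [c00 _ _ _] := curv x Ux; apply: (mulfI (E0 x Ux)).
  by move: c00; rewrite /second_form Etheta// -pdE ddFN// eqxx.
have k2E x : U x -> k2 x = k 1 x.
  move=> Ux; have [_ c11 _ _] := curv x Ux; apply: (mulfI (E0 x Ux)).
  by move: c11; rewrite /second_form Etheta// -pdE ddFN// eqxx.
have HE x : U x -> H x = meanH k x by move=> Ux; rewrite /H k1E// k2E.
have dHE i x : U x -> partial i H x = pd i (meanH k) x.
  by move=> Ux; rewrite pdE; apply: partial_congr HE Ux.
have LE x : U x -> L x = skewL E k x by move=> Ux; rewrite /L Etheta// k1E// k2E.
have ME x : U x -> M x = prodM E k x by move=> Ux; rewrite /M HE// LE.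
have etaE i x v : U x -> v *m eta i x = (sgn R i / E x) *: etav F i x v.
  move=> Ux; have [e0 e1] := corr F theta lift conf x Ux.
  have Einv : expR (- 2 * theta x) = (E x)^-1 by rewrite mulNr expRN Etheta.
  have [->|->] := ord2P i; rewrite ?e0 ?e1 -scalemxAr wedgeE Einv /etav /sgn /= pdE.
    by rewrite lipNl mulN1r scalerN !scaleNr opprK -[RHS]scalerN opprB addrC.
  by rewrite mul1r.
have eqE A B C D x : U x -> special_equation w E k A B C D x <->
     expR (2 * theta x) * ((partial 0 H x) ^+ 2 + (partial 1 H x) ^+ 2)
     + 1 / 4 * M x ^+ 2 + A * M x - 2 * B * H x + C * L x + D
     + 1 / 4 * L x ^+ 2 * K = 0.
  by move=> Ux; rewrite /special_equation Etheta// !dHE// ME// HE// LE.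
split.
  move=> /(special_of_special_isothermic oU sF sE sk E0 FF Fw sN NN NF Nw NdF
    dFdF ddFN etaE cU) [A [B [C [D h]]]].
  by exists A, B, C, D => x Ux; apply/eqE/h.
move=> [A [B [C [D h]]]].
have dHi i x : U x -> pd i (meanH k) x != 0.
  move=> Ux; have := dH_neq0 x Ux; rewrite !dHE// mulf_eq0 negb_or => /andP[].
  by have [->|->] := ord2P i.
apply: (special_isothermic_of_special oU sF sE sk E0 FF Fw sN NN NF Nw NdF
  dFdF ddFN etaE (A := A) (B := B) (C := C) (D := D)) => //; first by exists x0.
by move=> x Ux; apply/eqE => //; apply: h.
Qed.
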